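(* For each integer $n\geq 1$, let $a_n$ be the smallest integer $k\geq 1$ such that $s_k(n)$ is prime, if the sequence $(s_k(n))_{k\geq 0}$ contains a prime, and let $a_n=-1$ otherwise. Then: (1) if $n=\mathcal{T}_2(j)$ for some integer $j\geq 3$, then $a_n=-1$; (2) if $n=\mathcal{T}_p(j)$ for some integer $j\geq 3$ and some odd prime $p$, then either $s_{(p-1)/2}(n)$ is not prime and $a_n=-1$, or $s_{(p-1)/2}(n)$ is the only prime in the sequence $(s_k(n))_{k\geq 0}$ and $a_n=(p-1)/2$.
   Context: For an integer $n$, the sequence $(s_k(n))_{k\in\mathbb{Z}}$ is defined by $s_0(n)=1$, $s_1(n)=n+1$ and $s_{k+2}(n)=n\,s_{k+1}(n)-s_k(n)$ for all $k\in\mathbb{Z}$. The dilated Chebyshev polynomials of the first kind $\mathcal{T}_k$ ($k\in\mathbb{Z}$) are the polynomials with $\mathcal{T}_k(2\cos\theta)=2\cos(k\theta)$; equivalently $\mathcal{T}_0(x)=2$, $\mathcal{T}_1(x)=x$, $\mathcal{T}_{k+2}(x)=x\,\mathcal{T}_{k+1}(x)-\mathcal{T}_k(x)$. In particular $\mathcal{T}_2(j)=j^2-2$. *)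

(* Defs.v *)
From mathcomp Require Import all_boot all_order all_algebra.
From mathcomp Require Import boolp.

Set Implicit Arguments.
Unset Strict Implicit.
Unset Printing Implicit Defensive.

Import Order.TTheory GRing.Theory Num.Theory.
Local Open Scope ring_scope.

Fixpoint lrec_nat (R : pzRingType) (x u0 u1 : R) (k : nat) : R :=
  if k is k'.+1 then lrec_nat x u1 (x * u1 - u0) k' else u0.

(* The two-sided solution of u (k + 2) = x * u (k + 1) - u k with given u 0
   and u 1.  The recurrence is invariant under k |-> - k, so the negative half
   is the forward recursion started at u 0 and u (-1) = x * u 0 - u 1. *)
Definition lrec (R : pzRingType) (x u0 u1 : R) (k : int) : R :=
  match k with
  | Posz m => lrec_nat x u0 u1 m
  | Negz m => lrec_nat x u0 (x * u0 - u1) m.+1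
  end.

Lemma lrec_natSS (R : pzRingType) (x u0 u1 : R) (k : nat) :
  lrec_nat x u0 u1 k.+2 = x * lrec_nat x u0 u1 k.+1 - lrec_nat x u0 u1 k.
Proof. by elim: k u0 u1 => [|k IHk] u0 u1 //; rewrite -[LHS]/(lrec_nat _ _ _ k.+2) IHk. Qed.

Lemma lrecDD (R : pzRingType) (x u0 u1 : R) (k : int) :
  lrec x u0 u1 (k + 2) = x * lrec x u0 u1 (k + 1) - lrec x u0 u1 k.
Proof.
case: k => [k|[|[|k]]].
- have -> : Posz k + 2 = Posz k.+2 by rewrite -PoszD addn2.
  have -> : Posz k + 1 = Posz k.+1 by rewrite -PoszD addn1.
  exact: lrec_natSS.
- by rewrite -[Negz 0 + 2]/(Posz 1) -[Negz 0 + 1]/(Posz 0) /lrec /= subKr.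
- by rewrite -[Negz 1 + 2]/(Posz 0) -[Negz 1 + 1]/(Negz 0) /lrec /= subKr.
- have -> : Negz k.+2 + 2 = Negz k by rewrite !NegzE -addn2 PoszD opprD subrK.
  have -> : Negz k.+2 + 1 = Negz k.+1.
    by rewrite !NegzE -addn1 PoszD opprD subrK.
  by rewrite /lrec [lrec_nat _ _ _ k.+3]lrec_natSS subKr.
Qed.

Definition s (k n : int) : int := lrec n 1 (n + 1) k.

Lemma s0 (n : int) : s 0 n = 1. Proof. by []. Qed.
Lemma s1 (n : int) : s 1 n = n + 1. Proof. by []. Qed.
Lemma sDD (k n : int) : s (k + 2) n = n * s (k + 1) n - s k n.
Proof. exact: lrecDD. Qed.

Definition chebT (k : int) : {poly int} := lrec 'X 2%:R 'X k.

Lemma chebT0 : chebT 0 = 2%:R. Proof. by []. Qed.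
Lemma chebT1 : chebT 1 = 'X. Proof. by []. Qed.
Lemma chebTDD (k : int) : chebT (k + 2) = 'X * chebT (k + 1) - chebT k.
Proof. exact: lrecDD. Qed.
Lemma chebT2_eval (j : int) : (chebT 2).[j] = j ^+ 2 - 2%:R.
Proof. by rewrite /chebT /= -expr2 -polyC_natr !hornerE. Qed.

(* Primes are positive: -2 is not one. *)
Definition primez (m : int) : bool := (0 <= m) && prime `|m|%N.

Definition a_ (n : int) : int :=
  if pselect (exists k : nat, (1 <= k)%N && primez (s k n)) is left ex
  then Posz (ex_minn ex) else -1.

(* Since s 0 n = 1 is not prime, the restriction k >= 1 in the existence test
   of a_ does not matter. *)
Lemma a_P (n a : int) :
  a_ n = a <->
  (exists m : nat, [/\ a = m, (1 <= m)%N, primez (s m n) &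
     forall k : nat, (1 <= k)%N -> primez (s k n) -> (m <= k)%N]) \/
  (~ (exists k : nat, primez (s k n)) /\ a = -1).
Proof.
have ex1 : (exists k : nat, primez (s k n)) ->
           exists k : nat, (1 <= k)%N && primez (s k n).
  by case=> -[|k] // pk; exists k.+1.
rewrite /a_; case: pselect => [ex|nex].
- case: ex_minnP => m /andP[m1 pm] mmin; split.
    by move<-; left; exists m; split=> // k k1 pk; apply: mmin; rewrite k1.
  case=> [[m' [-> m'1 pm' m'min]]|[]]; last by case; exists m.
  by congr Posz; apply/eqP; rewrite eqn_leq m'min // mmin // m'1.
split; first by move<-; right; split=> // /ex1.
by case=> [[m [_ m1 pm _]]|[_ ->] //]; case: nex; exists m; rewrite m1.
Qed.

(* Main.v *)
(** With [j = u + 1/u] one has [s_k(T_p(j)) = sigma(p(2k+1)) / sigma(p)], where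
[sigma(m) = (u^(m/2) - u^(-m/2)) / (u^(1/2) - u^(-1/2))] and
[s_k(j) = sigma(2k+1)].  If [p] does not divide [2k+1], then [sigma(2k+1)] and
[sigma(p)] are coprime, so [s_k(j)] is a proper divisor of [s_k(T_p(j))].  If
[2k+1 = p(2m+1)], then [s_k(n) = s_m(T_p(n)) s_((p-1)/2)(n)], which is composite
unless [m = 0].  For [p = 2], [s_k(j^2-2)] is a difference of squares of
Chebyshev polynomials of the second kind. *)
Require Import Defs.
From mathcomp Require Import all_boot all_order all_algebra.
From mathcomp Require Import zify ring.

Import Order.TTheory GRing.Theory Num.Theory.
Local Open Scope ring_scope.

Lemma nat_ind2 (P : nat -> Prop) :
  P 0%N -> P 1%N -> (forall k, P k -> P k.+1 -> P k.+2) -> forall k, P k.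
Proof.
move=> P0 P1 PS k; suff [] : P k /\ P k.+1 by [].
by elim: k => // k [Pk Pk1]; split; last exact: PS.
Qed.

Lemma chebT_evalSS (k : nat) (x : int) :
  (chebT k.+2).[x] = x * (chebT k.+1).[x] - (chebT k).[x].
Proof.
have := chebTDD k; rewrite -!PoszD addn2 addn1 => ->.
by rewrite !hornerE.
Qed.

Lemma chebT0_eval (x : int) : (chebT 0).[x] = 2.
Proof. by rewrite chebT0 -polyC_natr !hornerE. Qed.

Lemma chebT1_eval (x : int) : (chebT 1).[x] = x.
Proof. by rewrite chebT1 hornerX. Qed.

Lemma sSS (k : nat) (x : int) : s k.+2 x = x * s k.+1 x - s k x.
Proof. by have := sDD k x; rewrite -!PoszD addn2 addn1. Qed.

(** For [x = u + 1/u], [(chebT i).[x]] is [u^i + u^-i], so this is a product-to-sum identity. Both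
    sides obey the same recurrence in [i]. *)
Lemma s_addsub (x a : int) (i : nat) :
  s (a + i%:Z) x + s (a - i%:Z) x = (chebT i).[x] * s a x.
Proof.
elim/nat_ind2: i => [||i IH0 IH1].
- have -> : a + 0%:Z = a by lia.
  by rewrite chebT0_eval; ring.
- rewrite chebT1_eval; have := sDD (a - 1) x.
  have -> : a - 1 + 2 = a + 1 by ring.
  by rewrite subrK => ->; ring.
- rewrite chebT_evalSS.
  have E1 := sDD (a + i%:Z) x; have E2 := sDD (a - i.+2%:Z) x.
  have D1 : a + i%:Z + 2 = a + i.+2%:Z by lia.
  have D2 : a + i%:Z + 1 = a + i.+1%:Z by lia.
  have D3 : a - i.+2%:Z + 2 = a - i%:Z by lia.
  have D4 : a - i.+2%:Z + 1 = a - i.+1%:Z by lia.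
  rewrite D1 D2 in E1; rewrite D3 D4 in E2.
  rewrite E1 mulrBl -mulrA -IH1 -IH0 E2; ring.
Qed.

(** [s a x] is [sigma(2a+1)] with [sigma] odd, and [a |-> -1 - a] negates [2a+1]. *)
Lemma s_refl_nat (x : int) (i : nat) : s (- 1 - i%:Z) x = - s i x.
Proof.
elim/nat_ind2: i => [||i IH0 IH1].
- have : s 1 x = x * s 0 x - s (-1) x := sDD (-1) x.
  by change (s (- 1 - 0%:Z) x) with (s (-1) x); rewrite s0 s1; lia.
- have : s 1 x = x * s 0 x - s (-1) x := sDD (-1) x.
  have : s 0 x = x * s (-1) x - s (-2) x := sDD (-2) x.
  by change (s (- 1 - 1%:Z) x) with (s (-2) x); rewrite s0 s1; nia.
- have := sDD (- 1 - i.+2%:Z) x.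
  have -> : - 1 - i.+2%:Z + 2 = - 1 - i%:Z by lia.
  have -> : - 1 - i.+2%:Z + 1 = - 1 - i.+1%:Z by lia.
  rewrite sSS IH0 IH1 => E; lia.
Qed.

Lemma s_refl (x a : int) : s (- 1 - a) x = - s a x.
Proof.
case: a => i; first exact: s_refl_nat.
have -> : Negz i = - 1 - i%:Z by lia.
by rewrite s_refl_nat opprK; congr (s _ x); lia.
Qed.

(** The index on the left is the [i] with [2i+1 = (2h+1)(2k+1)]. By [s_addsub] with step [2h+1], the
    left side satisfies in [k] the recurrence with parameter [(chebT h.*2.+1).[x]]. *)
Lemma s_mul (x : int) (h k : nat) :
  s (h.*2.+1 * k + h)%N x = s k (chebT h.*2.+1).[x] * s h x.
Proof.
elim/nat_ind2: k => [||k IH0 IH1].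
- by rewrite muln0 add0n s0 mul1r.
- have := s_addsub x h h.*2.+1.
  have -> : h%:Z - h.*2.+1%:Z = - 1 - h%:Z by lia.
  rewrite s_refl -PoszD muln1 addnC s1 => E; lia.
- have := s_addsub x (h.*2.+1 * k.+1 + h)%N h.*2.+1.
  have -> : (h.*2.+1 * k.+1 + h)%N%:Z + h.*2.+1%:Z
             = (h.*2.+1 * k.+2 + h)%N by lia.
  have -> : (h.*2.+1 * k.+1 + h)%N%:Z - h.*2.+1%:Z
             = (h.*2.+1 * k + h)%N by lia.
  rewrite IH0 IH1 sSS => E; rewrite mulrBl -mulrA; lia.
Qed.

(* Modulo [s h x], the reflection [s (h + i) = - s (h - i)] given by [s_addsub],
   composed with [s_refl], is a translation by [2h + 1]. *)
Lemma dvdz_s_period1 (x a : int) (h : nat) :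
  (s h x %| s (a + h.*2.+1%:Z) x - s a x)%Z.
Proof.
(* The step [a + h + 1] given to [s_addsub] must be a natural number. For smaller [a], [s_refl]
   turns the difference into the one at [-1 - (a + 2h + 1)]. *)
wlog Ha : a / -1 - h%:Z <= a => [W|].
  have [/W//|Ha] := lerP (-1 - h%:Z) a.
  have := W (- 1 - (a + h.*2.+1%:Z)) ltac:(lia).
  have -> : - 1 - (a + h.*2.+1%:Z) + h.*2.+1%:Z = - 1 - a by ring.
  by rewrite !s_refl opprK addrC.
have := s_addsub x h (absz (a + h%:Z + 1)).
have -> : h%:Z + (absz (a + h%:Z + 1))%:Z = a + h.*2.+1%:Z by lia.
have -> : h%:Z - (absz (a + h%:Z + 1))%:Z = - 1 - a by lia.
by rewrite s_refl => ->; rewrite dvdz_mull.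
Qed.

Lemma dvdz_s_period (x a m : int) (h : nat) :
  (s h x %| s (a + m * h.*2.+1%:Z) x - s a x)%Z.
Proof.
have per (b : int) (i : nat) : (s h x %| s (b + i%:Z * h.*2.+1%:Z) x - s b x)%Z.
  elim: i => [|i IH]; first by rewrite mul0r addr0 subrr.
  have := dvdz_s_period1 x (b + i%:Z * h.*2.+1%:Z) h.
  have -> : b + i%:Z * h.*2.+1%:Z + h.*2.+1%:Z = b + i.+1%:Z * h.*2.+1%:Z by lia.
  by move=> D; rewrite -(subrKA (s (b + i%:Z * h.*2.+1%:Z) x)) rpredD.
case: m => i; first exact: per.
have := per (a + Negz i * h.*2.+1%:Z) i.+1.
have -> : a + Negz i * h.*2.+1%:Z + i.+1%:Z * h.*2.+1%:Z = a by lia.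
by rewrite -opprB rpredN.
Qed.

(* A common divisor [d] makes [s] periodic mod [d] with periods [2h+1] and [2k+1],
   hence constant, so [1 = s 0 = s h = 0] mod [d]. *)
Lemma coprimez_s (x : int) (h k : nat) :
  coprime h.*2.+1 k.*2.+1 -> coprimez (s h x) (s k x).
Proof.
move=> cop; rewrite /coprimez; set d := gcdz _ _.
have dh : (d %| s h x)%Z := dvdz_gcdl _ _.
have dk : (d %| s k x)%Z := dvdz_gcdr _ _.
have /coprimezP[[u v] /= uv] : coprimez h.*2.+1%:Z k.*2.+1%:Z by [].
suff : (d %| s 0 x)%Z by rewrite s0 dvdz1.
(* By Bezout [b = h v (2k+1)]: it differs from [h] by a multiple of [2h+1] and from [0] by a
   multiple of [2k+1]. *)
pose b := h%:Z - h%:Z * u * h.*2.+1%:Z.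
have := dvdz_trans dk (dvdz_s_period x b (- (h%:Z * v)) k).
have -> : b + - (h%:Z * v) * k.*2.+1%:Z = 0.
  transitivity (h%:Z * (1 - (u * h.*2.+1%:Z + v * k.*2.+1%:Z))).
    by rewrite /b; ring.
  by rewrite uv subrr mulr0.
have := dvdz_trans dh (dvdz_s_period x h (- (h%:Z * u)) h).
rewrite mulNr -/b => db d0.
by rewrite -(subrK (s b x) (s 0 x)) rpredD // -(subrK (s h x) (s b x)) rpredD.
Qed.

Lemma s_growth (x : int) (k : nat) : 3 <= x ->
  0 < s k x /\ 2 * s k x < s k.+1 x.
Proof.
move=> x3; elim: k => [|k [IH0 IH1]]; first by rewrite s0 s1; lia.
rewrite sSS; split; first lia.
by nia.
Qed.

Lemma s_gt1 (x : int) (k : nat) : 3 <= x -> (0 < k)%N -> 1 < s k x.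
Proof. by case: k => // k x3 _; have [] := s_growth x k x3; lia. Qed.

(** The inductive step is [s (k+2) x < x * s (k+1) x < (y-1) * s (k+1) y < s (k+2) y], the last
    since [s k y < s (k+1) y]. *)
Lemma s_lt (x y : int) (k : nat) :
  3 <= x -> x + 2 < y -> (0 < k)%N -> s k x < s k y.
Proof.
move=> x3 xy; elim: k => // k IH _.
have y3 : 3 <= y by lia.
case: k IH => [|k] IH; first by rewrite !s1; lia.
have {}IH := IH isT.
have [a0 a1] := s_growth x k x3; have [b0 b1] := s_growth y k y3.
rewrite !sSS; nia.
Qed.

Lemma chebT_eval_growth (x : int) (k : nat) : 3 <= x ->
  0 < (chebT k).[x] /\ (chebT k).[x] < (chebT k.+1).[x].
Proof.
move=> x3; elim: k => [|k [IH0 IH1]].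
  by rewrite chebT0_eval chebT1_eval; lia.
by rewrite chebT_evalSS; split; [lia|nia].
Qed.

Lemma chebT_eval_gt (x : int) (k : nat) : 3 <= x -> (2 < k)%N ->
  x + 2 < (chebT k).[x].
Proof.
move=> x3; case: k => [|[|[|k]]] // _.
elim: k => [|k IH]; last by have [_] := chebT_eval_growth x k.+3 x3; lia.
rewrite !chebT_evalSS chebT0_eval chebT1_eval.
(* This bounds the cubic [x^3 - 3x] below by [3x^2 - 3x], leaving a quadratic inequality. *)
have : 0 <= (x - 3) * (x * x) by rewrite mulr_ge0 //; nia.
nia.
Qed.

Lemma primezM (x y : int) : 1 < x -> 1 < y -> ~ primez (x * y).
Proof.
case: x y => [x|//] [y|//]; rewrite !ltz_nat => x1 y1 /andP[_].
rewrite -PoszM absz_nat => /primeP[_ /(_ x)].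
rewrite dvdn_mulr // => /(_ isT); nia.
Qed.

(** With [j = u + 1/u], [g i] is [(u^i - u^-i)/(u - u^-1)], and the left side equals [g (2k+1)], a
    difference of two squares. *)
Lemma s_chebT2_factor (j : int) (k : nat) :
  let g i := lrec_nat j 0 1 i in
  s k (chebT 2).[j] = (g k.+1 - g k) * (g k.+1 + g k).
Proof.
move=> g; elim/nat_ind2: k => [||k IH0 IH1].
- by rewrite s0 /g /=; ring.
- by rewrite chebT2_eval s1 /g /=; ring.
- rewrite sSS IH0 IH1 chebT2_eval.
  have gSS i : g i.+2 = j * g i.+1 - g i by exact: lrec_natSS.
  rewrite !gSS; ring.
Qed.

Lemma s_chebT2_not_prime (j : int) (k : nat) :
  3 <= j -> ~ primez (s k (chebT 2).[j]).
Proof.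
case: k => [|k] j3; first by rewrite s0.
rewrite s_chebT2_factor.
(* Doubling makes even the smaller factor, the difference, exceed [g (k+1) >= 1]. *)
suff [] : 0 < lrec_nat j 0 1 k.+1 /\
    2 * lrec_nat j 0 1 k.+1 < lrec_nat j 0 1 k.+2.
  by move=> ? ?; apply: primezM; lia.
elim: k => [|k [IH0 IH1]]; first by rewrite /=; lia.
by rewrite (lrec_natSS _ _ _ k.+1); split; [lia|nia].
Qed.

Lemma s_chebT_prime_index (j : int) (h k : nat) :
  3 <= j -> prime h.*2.+1 ->
  primez (s k (chebT h.*2.+1).[j]) -> k = h.
Proof.
move=> j3 p_pr; set n := (chebT _).[j].
have h_gt0 : (0 < h)%N by case: h p_pr {n}.
have jn : j + 2 < n by apply: chebT_eval_gt => //; lia.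
case: (posnP k) => [->|k_gt0]; first by rewrite s0.
have [/dvdnP[M kM]|] := boolP (h.*2.+1 %| k.*2.+1)%N.
- have M_odd : odd M by have := congr1 odd kM; rewrite oddM /= !odd_double andbT.
  have {}kM : k = (h.*2.+1 * M./2 + h)%N.
    by move: kM; rewrite -(odd_double_half M) M_odd; nia.
  rewrite kM s_mul; case: (posnP M./2) => [->|m_gt0]; first by rewrite muln0.
  have n3 : 3 <= n by lia.
  have Tn : n + 2 < (chebT h.*2.+1).[n] by apply: chebT_eval_gt => //; lia.
  move/primezM; case; apply: s_gt1 => //; lia.
- rewrite -prime_coprime // => /(@coprimez_s j) cop.
  (* Exchanging [h] and [k] in [s_mul] shows that [s k j] divides [s k n * s h j]; the factor
     [s h j] is coprime to it. *)
  have /dvdzP[c nE] : (s k j %| s k n)%Z.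
    rewrite coprimez_sym in cop.
    rewrite -(Gauss_dvdzl _ cop) /n -s_mul.
    have -> : (h.*2.+1 * k + h = k.*2.+1 * h + k)%N by lia.
    by rewrite s_mul dvdz_mull.
  (* From [1 < s k j < s k n], the cofactor [c] also exceeds 1. *)
  have sj := s_gt1 j k j3 k_gt0; have sn := s_lt j n k j3 jn k_gt0.
  by rewrite nE => /primezM; case => //; nia.
Qed.

Theorem theorem38 (n : int) (hn : 1 <= n) :
  ((exists2 j : int, 3 <= j & n = (chebT 2).[j]) -> a_ n = -1) /\
  (forall (j : int) (p : nat),
     3 <= j -> prime p -> odd p -> n = (chebT p).[j] ->
     (~ primez (s (p.-1)./2 n) /\ a_ n = -1) \/
     (primez (s (p.-1)./2 n) /\
      (forall k : nat, primez (s k n) -> k = (p.-1)./2) /\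
      a_ n = (p.-1)./2)).
Proof.
split=> [[j j3 ->]|j p j3 p_pr p_odd nE].
  by apply/a_P; right; split=> // -[k]; apply: s_chebT2_not_prime.
set h := p.-1./2.
have pE : p = h.*2.+1 by rewrite /h; lia.
have idx (k : nat) : primez (s k n) -> k = h.
  by rewrite nE pE; apply: (s_chebT_prime_index j) => //; rewrite -pE.
have [sh|/negP sh] := boolP (primez (s h n)); [right|left].
  split=> //; split=> //; apply/a_P; left; exists h; split=> //.
    by have := prime_gt1 p_pr; lia.
  by move=> k _ /idx ->.
split=> //; apply/a_P; right; split=> // -[k sk].
by apply: sh; rewrite -(idx k sk).
Qed.
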